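(* For any weak composition $a$ of length $n$, \[ \overline{\mathfrak{F}}_a^{(\beta)}=\sum_{\substack{b\ge a\\ b^+=a^+}}\overline{\mathfrak{P}}_b^{(\beta)}, \] where the sum is over weak compositions $b$ of length $n$, $\overline{\mathfrak{F}}_a^{(\beta)}$ is the glide polynomial of $a$ and $\overline{\mathfrak{P}}_b^{(\beta)}$ is the kaon of $b$.
   Context: Fix $n\ge1$; $\beta$ is a formal parameter. A weak composition of length $n$ is a sequence $a=(a_1,\dots,a_n)$ of nonnegative integers, and $\mathbf{x}^a=x_1^{a_1}\cdots x_n^{a_n}$. The positive part $a^+$ is the sequence obtained by deleting all zeros of $a$. $b\ge a$ means $b_1+\dots+b_i\ge a_1+\dots+a_i$ for all $1\le i\le n$. A weak komposition is a weak composition whose positive entries are each colored black or red (different colorings are different weak kompositions); its excess $\mathrm{ex}$ is the number of red entries. Let $a$ have nonzero entries exactly in positions $n_1<\dots<n_\ell$, and put $n_0=0$. A weak komposition $b$ of length $n$ is a glide of $a$ if there exist integers $0=i_0<i_1<\dots<i_\ell$ such that $b_k=0$ for $k>i_\ell$ and, for each $1\le j\le\ell$: $a_{n_j}=b_{i_{j-1}+1}+\dots+b_{i_j}-\mathrm{ex}(b_{i_{j-1}+1},\dots,b_{i_j})$; $i_j\le n_j$; and the leftmost nonzero entry among $b_{i_{j-1}+1},\dots,b_{i_j}$ is black. The glide polynomial is $\overline{\mathfrak{F}}_a^{(\beta)}=\sum_b\beta^{\mathrm{ex}(b)}\mathbf{x}^b$ over all glides $b$ of $a$. A weak komposition $b$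 of length $n$ is a mesonic glide of $a$ if $b_k=0$ for $k>n_\ell$ and, for each $1\le j\le\ell$: $a_{n_j}=b_{n_{j-1}+1}+\dots+b_{n_j}-\mathrm{ex}(b_{n_{j-1}+1},\dots,b_{n_j})$; the leftmost nonzero entry among $b_{n_{j-1}+1},\dots,b_{n_j}$ is black; and $b_{n_j}\ne0$. The kaon is $\overline{\mathfrak{P}}_a^{(\beta)}=\sum_b\beta^{\mathrm{ex}(b)}\mathbf{x}^b$ over all mesonic glides $b$ of $a$. *)

(* Defs.v *)
From mathcomp Require Import all_boot all_order all_algebra.
From mathcomp.multinomials Require Import mpoly.

Set Implicit Arguments.
Unset Strict Implicit.
Unset Printing Implicit Defensive.

(* A weak composition of length n is a multinomial a : 'X_{1..n}, so that x^a
   is 'X_[a].  The index k : 'I_n stands for the 1-based position k + 1; hence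
   the positions lo + 1, ..., hi are the k : 'I_n with lo <= k < hi.

   A weak komposition is a weak composition b together with the set R of the
   positions of its red entries; all other nonzero entries are black. *)
Definition wkomp n (b : 'X_{1..n}) (R : {set 'I_n}) : bool :=
  R \subset [set k | b k != 0].

Definition pospart n (a : 'X_{1..n}) : seq nat := [seq x <- a | x != 0].

Definition wdom n (b a : 'X_{1..n}) : bool :=
  [forall i : 'I_n, \sum_(k < n | k <= i) a k <= \sum_(k < n | k <= i) b k].

(* The sequence n_0 = 0 < n_1 < ... < n_l of 1-based positions. *)
Definition npos n (a : 'X_{1..n}) : seq nat :=
  0 :: [seq (val k).+1 | k <- enum 'I_n & a k != 0].

Definition nlen n (a : 'X_{1..n}) : nat := (size (npos a)).-1.

Definition nentry n (a : 'X_{1..n}) (j : nat) : nat :=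
  nth 0 a (nth 0 (npos a) j).-1.

Section Blocks.
Variables (n : nat) (b : 'X_{1..n}) (R : {set 'I_n}).

Definition block_ex (lo hi : nat) : nat := #|[set k in R | lo <= k < hi]|.

Definition block_black (lo hi : nat) : bool :=
  [exists k : 'I_n, [&& lo <= k < hi, b k != 0, k \notin R
    & [forall k' : 'I_n, (lo <= k' < k) ==> (b k' == 0)]]].

(* The subtraction never truncates on a weak komposition: red entries are
   positive. *)
Definition block_weight (lo hi : nat) : nat :=
  \sum_(k < n | lo <= k < hi) b k - block_ex lo hi.

End Blocks.

Definition glide_cuts n (a b : 'X_{1..n}) (R : {set 'I_n}) (i : seq nat) :=
  [&& size i == (nlen a).+1, nth 0 i 0 == 0, sorted ltn i,
      [forall k : 'I_n, (nth 0 i (nlen a) <= k) ==> (b k == 0)]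
    & [forall j : 'I_(nlen a),
        [&& nentry a j.+1 == block_weight b R (nth 0 i j) (nth 0 i j.+1),
            nth 0 i j.+1 <= nth 0 (npos a) j.+1
          & block_black b R (nth 0 i j) (nth 0 i j.+1)]]].

(* The cuts satisfy i_j <= n_j <= n, so they may be taken in 'I_n.+1; see
   glideP. *)
Definition glide n (a b : 'X_{1..n}) (R : {set 'I_n}) : bool :=
  wkomp b R &&
  [exists i : (nlen a).+1.-tuple 'I_n.+1, glide_cuts a b R (map val i)].

Definition mesonic_glide n (a b : 'X_{1..n}) (R : {set 'I_n}) : bool :=
  [&& wkomp b R,
      [forall k : 'I_n, (nth 0 (npos a) (nlen a) <= k) ==> (b k == 0)]
    & [forall j : 'I_(nlen a),
        let lo := nth 0 (npos a) j in
        let hi := nth 0 (npos a) j.+1 in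
        [&& nentry a j.+1 == block_weight b R lo hi,
            block_black b R lo hi
          & nth 0 b hi.-1 != 0]]].

(* The polynomials live in Z[beta][x_1, ..., x_n], with beta the variable of
   {poly int}.  The degree bounds on b only serve to make the index types
   finite; they exclude no glide, by glide_mdeg and mesonic_glide_mdeg. *)
Definition glide_poly n (a : 'X_{1..n}) : {mpoly {poly int}[n]} :=
  (\sum_(b : 'X_{1..n < (mdeg a + n).+1})
    \sum_(R : {set 'I_n} | glide a b R) 'X ^+ #|R| *: 'X_[b])%R.

Definition kaon n (a : 'X_{1..n}) : {mpoly {poly int}[n]} :=
  (\sum_(b : 'X_{1..n < (mdeg a + n).+1})
    \sum_(R : {set 'I_n} | mesonic_glide a b R) 'X ^+ #|R| *: 'X_[b])%R.

Section Bounds.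
Variable n : nat.
Implicit Types (a b : 'X_{1..n}) (R : {set 'I_n}).

Lemma npos_le a x : x \in npos a -> x <= n.
Proof. by rewrite inE => /predU1P[->//|/mapP[k _ ->]]; apply: ltn_ord. Qed.

Lemma glideP a b R :
  reflect (wkomp b R /\ exists i : seq nat, glide_cuts a b R i) (glide a b R).
Proof.
apply: (iffP andP) => -[wR].
  by case/existsP=> i Hi; split=> //; exists (map val i).
case=> i Hi; split=> //; have /and5P[/eqP si /eqP i0 _ _ /forallP Hj] := Hi.
have le_i x : x \in i -> x < n.+1.
  case/(nthP 0) => -[|j] lt_j <-; first by rewrite i0.
  rewrite si ltnS in lt_j.
  have /and3P[_ le_ij _] := Hj (Ordinal lt_j).
  apply: leq_trans le_ij _; apply: (@npos_le a); apply: mem_nth.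
  by rewrite ltnS.
have Ei : map val (map (inord : nat -> 'I_n.+1) i) = i.
  rewrite -map_comp -[RHS]map_id; apply/eq_in_map => x /le_i lt_x /=.
  by rewrite inordK.
have si' : size (map (inord : nat -> 'I_n.+1) i) == (nlen a).+1.
  by rewrite size_map si.
by apply/existsP; exists (Tuple si'); rewrite /= Ei.
Qed.

Lemma sum_nentry a : \sum_(j < nlen a) nentry a j.+1 = mdeg a.
Proof.
rewrite /nlen /nentry /= -(big_mkord xpredT (fun j =>
  nth 0 a (nth 0 [seq (val k).+1 | k <- enum 'I_n & a k != 0] j).-1)).
rewrite -(big_nth 0 xpredT (fun x => nth 0 a x.-1)) big_map big_filter /=.
rewrite big_enum_cond /= mdegE big_mkcond; apply: eq_bigr => k _ /=.
by rewrite -mnm_nth; case: eqP.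
Qed.

Lemma blocks_mdeg a b R (i : seq nat) :
    nth 0 i 0 = 0 ->
    (forall k : 'I_n, nth 0 i (nlen a) <= k -> b k = 0) ->
    (forall j, j < nlen a ->
       nentry a j.+1 = block_weight b R (nth 0 i j) (nth 0 i j.+1) /\
       nth 0 i j <= nth 0 i j.+1) ->
  mdeg b <= mdeg a + #|R|.
Proof.
move=> i0 b0 Hj.
have step j : j <= nlen a ->
  \sum_(k < n | k < nth 0 i j) b k <=
  \sum_(j' < j) nentry a j'.+1 + #|[set k in R | k < nth 0 i j]|.
  elim: j => [|j IHj] lt_j; first by rewrite i0 big1.
  have [ej le_ij] := Hj j lt_j.
  rewrite (bigID (fun k : 'I_n => k < nth 0 i j)) /=.
  rewrite [X in X + _ <= _](eq_bigl (fun k : 'I_n => k < nth 0 i j)); last first.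
    by move=> k; rewrite andb_idl // => /leq_trans->.
  rewrite [X in _ + X <= _](eq_bigl
    (fun k : 'I_n => nth 0 i j <= k < nth 0 i j.+1)); last first.
    by move=> k; rewrite -leqNgt andbC.
  rewrite big_ord_recr /= ej.
  have -> : #|[set k in R | k < nth 0 i j.+1]| =
     #|[set k in R | k < nth 0 i j]| + block_ex R (nth 0 i j) (nth 0 i j.+1).
    rewrite -(cardsID [set k : 'I_n | k < nth 0 i j]
      [set k in R | k < nth 0 i j.+1]).
    congr (_ + _); apply: eq_card => k; rewrite !inE.
    - case: (ltnP k (nth 0 i j)) => [lt_k|]; rewrite ?andbF //.
      by rewrite (leq_trans lt_k) ?andbT.
    - by rewrite -leqNgt andbCA.
  rewrite addnACA; apply: leq_add; first exact: IHj (ltnW lt_j).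
  by rewrite /block_weight addnC -leq_subLR.
have := step _ (leqnn _); rewrite sum_nentry => le_b.
rewrite mdegE (bigID (fun k : 'I_n => k < nth 0 i (nlen a))) /=.
rewrite [X in _ + X]big1 ?addn0; last by move=> k; rewrite -leqNgt => /b0.
apply: leq_trans le_b _; rewrite leq_add2l subset_leq_card //.
by apply/subsetP=> k; rewrite inE => /andP[].
Qed.

Lemma glide_mdeg a b R : glide a b R -> mdeg b < (mdeg a + n).+1.
Proof.
case/glideP=> _ [i /and5P[/eqP si /eqP i0 srt /forallP b0 /forallP Hj]].
rewrite ltnS (@leq_trans (mdeg a + #|R|)) //; last first.
  by rewrite leq_add2l -[leqRHS]card_ord max_card.
apply: (@blocks_mdeg _ _ _ i) => // [k|j lt_j].
  by move=> le_k; apply/eqP; apply: (implyP (b0 k)).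
have /and3P[/eqP-> _ _] := Hj (Ordinal lt_j); split=> //.
by apply: ltnW; apply: (sorted_ltn_nth ltn_trans) => //; rewrite inE si ltnS // ltnW.
Qed.

Lemma sorted_npos a : sorted ltn (npos a).
Proof.
rewrite /npos /= path_min_sorted; last first.
  by apply/allP=> x /mapP[k _ ->].
rewrite sorted_map; apply: sorted_filter; first by move=> ? ? ?; apply: ltn_trans.
have -> : sorted (relpre (fun k : 'I_n => (val k).+1) ltn) (enum 'I_n)
  = sorted ltn (map val (enum 'I_n)) by rewrite sorted_map.
by rewrite val_enum_ord iota_ltn_sorted.
Qed.

Lemma mesonic_glide_mdeg a b R :
  mesonic_glide a b R -> mdeg b < (mdeg a + n).+1.
Proof.
case/and3P=> _ /forallP b0 /forallP Hj.
rewrite ltnS (@leq_trans (mdeg a + #|R|)) //; last first.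
  by rewrite leq_add2l -[leqRHS]card_ord max_card.
apply: (@blocks_mdeg _ _ _ (npos a)) => // [k|j lt_j].
  by move=> le_k; apply/eqP; apply: (implyP (b0 k)).
have /and3P[/eqP-> _ _] := Hj (Ordinal lt_j); split=> //.
by apply: ltnW; apply: (sorted_ltn_nth ltn_trans _ (sorted_npos a));
  rewrite ?inE //= ?ltnS // ltnW.
Qed.

Lemma pospart_mdeg a b : pospart b = pospart a -> mdeg b = mdeg a.
Proof.
have E m : mdeg m = sumn (pospart m).
  rewrite /mdeg /pospart sumnE big_filter [RHS]big_mkcond.
  by apply: eq_bigr => x _; case: eqP.
by rewrite !E => ->.
Qed.

End Bounds.

(* Main.v *)
(* Fix a colored weak komposition (b, R).  If it is a glide of a with cuts i_j,
   moving each i_j left to the last nonzero entry of b (trim) changes neither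
   the weights nor the leftmost nonzero entries of the blocks, and makes b a
   mesonic glide of the composition c carrying the parts of a at the new cuts;
   given c^+ = a^+, c >= a says exactly that each part of c lies weakly to the
   left of the corresponding part of a.  This c is unique: if a cut could be
   moved right to another nonzero entry of b, the block would absorb the black
   entry opening the next block, and become too heavy.  Hence each glide of a
   contributes to exactly one of the kaons. *)
Require Import Defs.
From mathcomp Require Import all_boot all_order all_algebra.
From mathcomp.multinomials Require Import mpoly.

Set Implicit Arguments.
Unset Strict Implicit.
Unset Printing Implicit Defensive.

(** * Positions of the parts, and dominance in terms of them *)

Section Positions.
Variable n : nat.
Implicit Types (a c : 'X_{1..n}).

Lemma mem_behead_npos a (k : 'I_n) : (k.+1 \in behead (npos a)) = (a k != 0).
Proof.
apply/mapP/idP => [[k' + [/ord_inj->]]|ak]; first by rewrite mem_filter => /andP[].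
by exists k; rewrite // mem_filter ak mem_enum.
Qed.

Lemma pospartE a : pospart a = [seq nth 0 a x.-1 | x <- behead (npos a)].
Proof.
rewrite /pospart /npos /= -[in LHS](map_tnth_enum (val a)) filter_map -map_comp.
by apply: eq_map => k /=; rewrite -mnm_nth.
Qed.

Lemma size_pospart a : size (pospart a) = nlen a.
Proof. by rewrite pospartE size_map size_behead. Qed.

Lemma nth_pospart a j : j < nlen a -> nth 0 (pospart a) j = nentry a j.+1.
Proof.
by move=> lt_j; rewrite pospartE (nth_map 0) ?nth_behead // size_behead.
Qed.

Lemma pospart_neq0 a : 0 \notin pospart a.
Proof. by rewrite mem_filter. Qed.

Lemma nentry_gt0 a j : j < nlen a -> 0 < nentry a j.+1.
Proof.
move=> lt_j; rewrite -nth_pospart // lt0n.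
by apply: contraNneq (pospart_neq0 a) => <-; rewrite mem_nth // size_pospart.
Qed.

Lemma ltn_npos a i j : i < j <= nlen a -> nth 0 (npos a) i < nth 0 (npos a) j.
Proof.
case/andP=> lt_ij le_j; apply: (sorted_ltn_nth ltn_trans _ (sorted_npos a)) => //;
by rewrite inE /= ltnS // (leq_trans (ltnW lt_ij)).
Qed.

Lemma leq_npos a i j : i <= j <= nlen a -> nth 0 (npos a) i <= nth 0 (npos a) j.
Proof.
by case/andP; rewrite leq_eqVlt => /predU1P[->//|*]; apply/ltnW/ltn_npos/andP.
Qed.

Lemma mnm_pospart a (k : 'I_n) :
  a k = nth 0 (pospart a) (index k.+1 (behead (npos a))).
Proof.
case: (boolP (k.+1 \in behead (npos a))) => [kin|kout].
  rewrite pospartE (nth_map 0) ?index_mem // nth_index //=.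
  by rewrite -mnm_nth.
(* Off the support, [index] returns the length of the list, so the default 0 is read. *)
rewrite nth_default; last by rewrite memNindex // size_pospart size_behead.
by apply/eqP; rewrite -[_ == _]negbK -mem_behead_npos.
Qed.

Lemma mnm_inj_npos a c : npos a = npos c -> pospart a = pospart c -> a = c.
Proof. by move=> eN eP; apply/mnmP => k; rewrite !mnm_pospart eN eP. Qed.

(** Supplies the composition that carries the parts of [a] at the trimmed cuts. *)
Lemma mnm_of_npos (p s : seq nat) :
    size s = size p -> 0 \notin p -> sorted ltn (0 :: s) ->
    {in s, forall x, x <= n} ->
  exists2 c : 'X_{1..n}, npos c = 0 :: s & pospart c = p.
Proof.
move=> sz p0 srt le_s.
have s_gt0 x : x \in s -> 0 < x.
  by move: srt; rewrite /= (path_sortedE ltn_trans) => /andP[/allP H _] /H.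
have us : uniq s by have /= /andP[] := sorted_uniq ltn_trans ltnn srt.
have nz_p j : j < size p -> nth 0 p j != 0.
  by move=> lt_j; apply: contraNneq p0 => <-; apply: mem_nth.
(* For [k.+1] outside [s] the index is [size s = size p], which yields the default 0. *)
pose c := [multinom nth 0 p (index k.+1 s) | k < n].
have cE x : x \in s -> nth 0 c x.-1 = nth 0 p (index x s).
  move=> xs; have lt_x : x.-1 < n by rewrite prednK ?le_s ?s_gt0.
  by rewrite -(mnm_nth 0 c (Ordinal lt_x)) mnmE /= prednK ?s_gt0.
have Nc : npos c = 0 :: s.
  congr (_ :: _); have /= /path_sorted Hs := sorted_npos c.
  apply: (irr_sorted_eq ltn_trans ltnn Hs); first exact: path_sorted srt.
  move=> x; apply/mapP/idP => [[k + ->]|xs].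
    rewrite mem_filter mnmE => /andP[H _]; apply: contraR H => ks.
    by rewrite nth_default // memNindex // sz.
  have lt_x : x.-1 < n by rewrite prednK ?le_s ?s_gt0.
  exists (Ordinal lt_x); rewrite /= ?prednK ?s_gt0 //.
  by rewrite mem_filter mem_enum (mnm_nth 0) /= cE // nz_p // -sz index_mem.
exists c => //; rewrite pospartE Nc /=.
apply: (@eq_from_nth _ 0) => [|j]; rewrite size_map // => lt_j.
by rewrite (nth_map 0) // cE ?mem_nth // index_uniq.
Qed.

(** Zero entries drop out, and a part at index [k < h] has 1-based position [k.+1 <= h]. *)
Lemma sum_lt_nentry a h :
  \sum_(k < n | k < h) a k =
  \sum_(j < nlen a | nth 0 (npos a) j.+1 <= h) nentry a j.+1.
Proof.
rewrite /nlen /nentry /= -(big_mkord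
  (fun j => nth 0 [seq (val k).+1 | k <- enum 'I_n & a k != 0] j <= h)
  (fun j => nth 0 a (nth 0 [seq (val k).+1 | k <- enum 'I_n & a k != 0] j).-1)).
rewrite -(big_nth 0 (fun x => x <= h) (fun x => nth 0 a x.-1)) big_map.
rewrite big_filter_cond /= big_enum_cond /= big_mkcond [RHS]big_mkcond.
apply: eq_bigr => k _ /=.
by rewrite -mnm_nth; case: (k < h); case: eqP.
Qed.

(** When the positive parts agree, all partial sums of both compositions add up initial runs of one
    list of positive numbers, so only the positions of the parts matter. *)
Lemma wdom_npos a c : pospart c = pospart a ->
  wdom c a = [forall j : 'I_(nlen a), nth 0 (npos c) j.+1 <= nth 0 (npos a) j.+1].
Proof.
move=> eP; have eL : nlen c = nlen a by rewrite -!size_pospart eP.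
have sum_c h : \sum_(k < n | k < h) c k =
    \sum_(j < nlen a | nth 0 (npos c) j.+1 <= h) nentry a j.+1.
  rewrite sum_lt_nentry eL; apply: eq_bigr => j _.
  by rewrite -!nth_pospart ?eP ?eL ?ltn_ord.
have dom_h : wdom c a ->
    forall j : 'I_(nlen a), nth 0 (npos c) j.+1 <= nth 0 (npos a) j.+1.
  move/forallP=> dom j; rewrite leqNgt; apply/negP => lt_ac.
  (* Dominance is tested on the prefix that ends at part [j] of [a]. *)
  set h := nth 0 (npos a) j.+1 in lt_ac.
  have h_gt0 : 0 < h by apply: (@ltn_npos a 0); rewrite ltn_ord.
  have h_le : h <= n by apply: (@npos_le _ a); apply: mem_nth; rewrite /= ltnS.
  have lt_h : h.-1 < n by rewrite prednK.
  have := dom (Ordinal lt_h) => /=.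
  have Eh (m : 'X_{1..n}) :
      \sum_(k < n | k <= h.-1) m k = \sum_(k < n | k < h) m k.
    by apply: eq_bigl => k; rewrite -[in RHS](prednK h_gt0).
  rewrite !Eh sum_c sum_lt_nentry leqNgt => /negP; apply.
  (* The sum for [a] contains the positive part [j]; the sum for [c] only has parts before [j], all
     of which the sum for [a] has too. *)
  rewrite [ltnRHS](bigD1 j) //.
  apply: (@leq_add 1); first exact: nentry_gt0.
  rewrite big_mkcond [leqRHS]big_mkcond; apply: leq_sum => j' _.
  case: ifP => // le_j'; case: ifP => //.
  have lt_j : j' < j.
    rewrite ltnNge; apply: contraL le_j' => le_j; rewrite -ltnNge.
    by apply: leq_trans lt_ac _; apply: leq_npos; rewrite eL ltnS le_j ltn_ord.
  by rewrite neq_ltn lt_j andbT leq_npos // ltnS (ltnW lt_j) ltn_ord.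
apply/idP/forallP => // le_ca; apply/forallP => i.
(* [k <= i] is [k < i.+1] by conversion. *)
rewrite (sum_c i.+1) (sum_lt_nentry a i.+1).
rewrite big_mkcond [leqRHS]big_mkcond; apply: leq_sum => j _ /=.
by case: ifP => // le_i; rewrite (leq_trans (le_ca j)).
Qed.

End Positions.

(** * Weights and opening entries of blocks, and trimming of cuts *)

Section Blocks.
Variables (n : nat) (b : 'X_{1..n}) (R : {set 'I_n}).

(** Red entries are positive, so the excess can be subtracted entry by entry without truncation. *)
Lemma block_weightE lo hi : wkomp b R ->
  block_weight b R lo hi = \sum_(k < n | lo <= k < hi) (b k - (k \in R)).
Proof.
move/subsetP=> wR; rewrite sumnB; last first.
  by move=> k _; case: (boolP (k \in R)) => // /wR; rewrite inE lt0n.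
congr (_ - _); rewrite /block_ex -sum1_card big_mkcond [RHS]big_mkcond.
by apply: eq_bigr => k _; rewrite inE; case: (k \in R); case: ifP.
Qed.

Lemma block_weight_cat lo mid hi : wkomp b R -> lo <= mid <= hi ->
  block_weight b R lo hi = block_weight b R lo mid + block_weight b R mid hi.
Proof.
move=> wR /andP[le1 le2]; rewrite !block_weightE //.
rewrite (bigID (fun k : 'I_n => k < mid)) /=; congr (_ + _);
  apply: eq_bigl => k; case: (ltnP k mid) => lt_k; rewrite ?andbF ?andbT //=.
- by rewrite (leq_trans lt_k) ?andbT.
- by rewrite (leq_trans le1).
Qed.

Lemma block_black_weight_gt0 lo hi : wkomp b R -> block_black b R lo hi ->
  0 < block_weight b R lo hi.
Proof.
move=> wR /existsP[k /and4P[k_in bk /negPf kR _]].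
by rewrite block_weightE // (bigD1 k) //= kR subn0 addn_gt0 lt0n bk.
Qed.

(** The opening entry cannot lie to the right of the nonzero entry [k], hence it lies before
    [mid]. *)
Lemma leq_block_black lo mid hi (k : 'I_n) : block_black b R lo hi ->
  lo <= k < mid -> b k != 0 -> block_black b R lo mid.
Proof.
case/existsP=> k0 /and4P[/andP[lo_k0 _] bk0 k0R /forallP z] /andP[lo_k k_mid] bk.
apply/existsP; exists k0; rewrite lo_k0 bk0 k0R /=; apply/andP; split; last exact/forallP.
apply: leq_ltn_trans k_mid; rewrite leqNgt; apply: contra bk => lt_k.
by apply: (implyP (z k)); rewrite lo_k.
Qed.

Section SameSupport.
Variables (lo hi lo' hi' : nat).
Hypothesis same : forall k : 'I_n, b k != 0 -> (lo <= k < hi) = (lo' <= k < hi').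

Lemma eq_block_weight : wkomp b R ->
  block_weight b R lo hi = block_weight b R lo' hi'.
Proof.
move=> wR; rewrite !block_weightE // big_mkcond [RHS]big_mkcond.
apply: eq_bigr => k _; case: (eqVneq (b k) 0) => [->|/same->//].
by rewrite sub0n !if_same.
Qed.

Lemma sub_block_black : block_black b R lo hi -> block_black b R lo' hi'.
Proof.
case/existsP=> k /and4P[k_in bk kR /forallP z]; apply/existsP; exists k.
have /andP[lo_k k_hi] := k_in; rewrite -same // k_in bk kR /=.
have /andP[lo'_k k_hi'] : lo' <= k < hi' by rewrite -same.
apply/forallP => k'; apply/implyP => /andP[lo'_k' lt_k'].
apply/negPn/negP => bk'; have /andP[lo_k' _] : lo <= k' < hi.
  by rewrite same // lo'_k' (ltn_trans lt_k').
by move: (z k'); rewrite lo_k' lt_k' (negPf bk').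
Qed.

End SameSupport.

(** The 1-based position of the last nonzero entry before the cut [h]; the empty maximum gives 0 if
    there is none. *)
Definition trim h := \max_(k < n | (k < h) && (b k != 0)) k.+1.

Lemma ltn_trim h (k : 'I_n) : b k != 0 -> (k < trim h) = (k < h).
Proof.
move=> bk; apply/idP/idP => [lt_k|lt_k]; last first.
  by apply: (@leq_bigmax_cond _ _ (fun k : 'I_n => k.+1) k); rewrite lt_k.
by apply: leq_trans lt_k _; apply/bigmax_leqP => k' /andP[].
Qed.

Lemma trim_leq h : trim h <= h.
Proof. by apply/bigmax_leqP => k /andP[]. Qed.

Lemma trim_neq0 h : 0 < trim h -> nth 0 b (trim h).-1 != 0.
Proof.
move=> h0; pose A := [pred k : 'I_n | (k < h) && (b k != 0)].
have A_gt0 : 0 < #|A|.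
  by rewrite lt0n; apply: contraTneq h0 => /card0_eq A0; rewrite /trim big_pred0.
have [k /andP[_ bk] E] := eq_bigmax_cond (fun k : 'I_n => k.+1) A_gt0.
by rewrite /trim E /= -mnm_nth.
Qed.

Lemma trim_block lo hi (k : 'I_n) : b k != 0 ->
  (lo <= k < hi) = (trim lo <= k < trim hi).
Proof. by move=> bk; rewrite (leqNgt (trim lo)) !ltn_trim // -leqNgt. Qed.

(** The black entry survives trimming and separates the two cuts, so trimmed cuts stay strictly
    increasing. *)
Lemma block_black_trim lo hi : block_black b R lo hi -> trim lo < trim hi.
Proof.
case/existsP=> k /and4P[k_in bk _ _].
by move: k_in; rewrite trim_block // => /andP[]; apply: leq_ltn_trans.
Qed.

End Blocks.

(** * Existence and uniqueness of the composition attached to a glide *)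

Section Glides.
Variable n : nat.
Implicit Types (a b c : 'X_{1..n}) (R : {set 'I_n}).

Lemma glide_mesonic_exists a b R : glide a b R ->
  exists c, [/\ wdom c a, pospart c = pospart a & mesonic_glide c b R].
Proof.
case/glideP=> wR [i /and5P[/eqP si /eqP i0 srt /forallP b0 /forallP Hj]].
pose t j := trim b (nth 0 i j).
have t0 : t 0 = 0 by apply/eqP; rewrite -leqn0 /t i0 trim_leq.
have t_lt j : j < nlen a -> t j < t j.+1.
  move=> lt_j; have /and3P[_ _ blk] := Hj (Ordinal lt_j).
  exact: block_black_trim blk.
have le_t j : j < nlen a -> t j.+1 <= nth 0 (npos a) j.+1.
  move=> lt_j; have /and3P[_ le_i _] := Hj (Ordinal lt_j).
  exact: leq_trans (trim_leq _ _) le_i.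
have [||||c Nc Pc] := @mnm_of_npos n (pospart a) [seq t j.+1 | j <- iota 0 (nlen a)].
- by rewrite size_map size_iota size_pospart.
- exact: pospart_neq0.
- apply/(pathP 0) => j; rewrite size_map size_iota => lt_j.
  rewrite (nth_map 0) ?size_iota // nth_iota //= add0n.
  case: j lt_j => [|j] lt_j /=; first by rewrite -[X in X < _]t0 t_lt.
  by rewrite (nth_map 0) ?size_iota ?nth_iota ?(ltnW lt_j) // t_lt.
- move=> x /mapP[j]; rewrite mem_iota => /= lt_j ->.
  apply: leq_trans (le_t _ lt_j) _; apply: (@npos_le _ a).
  by apply: mem_nth; rewrite /= ltnS.
have eL : nlen c = nlen a by rewrite -!size_pospart Pc.
have Nt j : j <= nlen a -> nth 0 (npos c) j = t j.
  rewrite Nc; case: j => [|j] lt_j; first by rewrite t0.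
  by rewrite /= (nth_map 0) ?size_iota // nth_iota.
exists c; split=> //.
  rewrite wdom_npos //; apply/forallP => j; rewrite Nt //; exact: le_t.
apply/and3P; split=> //; rewrite eL; apply/forallP; last move=> j.
  (* A nonzero entry beyond the last trimmed cut would lie beyond the original one. *)
  move=> k; rewrite Nt //; apply/implyP; apply: contraLR => bk.
  by rewrite -ltnNge ltn_trim // ltnNge; apply: contra bk; apply: (implyP (b0 k)).
rewrite !Nt ?(ltnW (ltn_ord j)) //=.
have /and3P[/eqP w_j _ blk] := Hj j.
have same := @trim_block n b (nth 0 i j) (nth 0 i j.+1).
rewrite -nth_pospart ?eL // Pc nth_pospart // w_j (eq_block_weight same) // eqxx /=.
rewrite (sub_block_black same) // trim_neq0 //.
by apply: leq_ltn_trans (t_lt j (ltn_ord j)).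
Qed.

(** The positions of [c] serve as cuts; dominance gives the bound by the positions of [a]. *)
Lemma mesonic_glide_glide a b c R :
  wdom c a -> pospart c = pospart a -> mesonic_glide c b R -> glide a b R.
Proof.
move=> dom Pc /and3P[wR b0 /forallP Hj].
have eL : nlen c = nlen a by rewrite -!size_pospart Pc.
apply/glideP; split=> //; exists (npos c).
apply/and5P; rewrite -eL; split; rewrite ?sorted_npos //.
apply/forallP => j; have /and3P[/eqP w_j blk _] := Hj j.
have lt_j : j < nlen a by rewrite -eL.
rewrite -nth_pospart // -Pc nth_pospart // w_j eqxx blk andbT /=.
by move: dom; rewrite wdom_npos // => /forallP/(_ (Ordinal lt_j)).
Qed.

Lemma mesonic_glide_npos_leq b c c' R j :
    mesonic_glide c b R -> mesonic_glide c' b R -> pospart c = pospart c' ->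
    j < nlen c -> nth 0 (npos c) j = nth 0 (npos c') j ->
  nth 0 (npos c') j.+1 <= nth 0 (npos c) j.+1.
Proof.
case/and3P=> wR /forallP b0 /forallP Hc /and3P[_ _ /forallP Hc'] eP lt_j eN.
have eL : nlen c = nlen c' by rewrite -!size_pospart eP.
have lt_j' : j < nlen c' by rewrite -eL.
rewrite leqNgt; apply/negP => lt_hi.
have /and3P[/eqP w_j _ _] := Hc (Ordinal lt_j).
have /and3P[/eqP w_j' _ nz] := Hc' (Ordinal lt_j').
rewrite /= in w_j w_j' nz.
set lo := nth 0 (npos c) j in w_j eN; set hi := nth 0 (npos c) j.+1 in w_j lt_hi.
set hi' := nth 0 (npos c') j.+1 in w_j' nz lt_hi.
have hi'_gt0 : 0 < hi' by apply: leq_ltn_trans lt_hi.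
have hi'_le : hi' <= n by apply: (@npos_le _ c'); apply: mem_nth; rewrite /= ltnS.
have lt_k : hi'.-1 < n by rewrite prednK.
pose k := Ordinal lt_k; have bk : b k != 0 by rewrite (mnm_nth 0).
have k_in : hi <= k < hi' by rewrite /= -ltnS prednK // lt_hi leqnn.
have /andP[hi_k k_hi'] := k_in.
(* Both blocks start at [lo] and have equal weight, so the surplus of the longer one weighs
   nothing. *)
have w0 : block_weight b R hi hi' = 0.
  have : nentry c j.+1 = nentry c' j.+1 by rewrite -!nth_pospart ?eP.
  rewrite w_j w_j' -eN (@block_weight_cat _ _ _ lo hi hi') //; last first.
    by rewrite (ltnW lt_hi) andbT leq_npos // leqnSn.
  by move/eqP; rewrite -[X in X == _]addn0 eqn_add2l => /eqP.
(* Past the last cut of [c], [b] vanishes, against [bk]; otherwise the next block of [c] opens with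
   a black entry at or before [k], so the surplus has positive weight. *)
have [eq_j|ne_j] := eqVneq j.+1 (nlen c).
  by move: (b0 k); rewrite -eq_j hi_k (negPf bk).
have lt_j1 : j.+1 < nlen c by rewrite ltn_neqAle ne_j.
have /and3P[_ blk _] := Hc (Ordinal lt_j1).
by have := block_black_weight_gt0 wR (leq_block_black blk k_in bk); rewrite w0.
Qed.

Lemma mesonic_glide_inj b c c' R :
    mesonic_glide c b R -> mesonic_glide c' b R -> pospart c = pospart c' ->
  c = c'.
Proof.
move=> Mc Mc' eP; apply: mnm_inj_npos (eP).
have eL : nlen c = nlen c' by rewrite -!size_pospart eP.
apply: (@eq_from_nth _ 0) => [|j]; first by congr _.+1.
rewrite ltnS; elim: j => [//|j IHj] lt_j.
have eN := IHj (ltnW lt_j).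
apply/eqP; rewrite eqn_leq; apply/andP; split.
- by apply: (mesonic_glide_npos_leq Mc' Mc); rewrite ?eP -?eL.
- exact: (mesonic_glide_npos_leq Mc Mc').
Qed.

(** Puts all kaons of the sum over one index type, so that the sums can be exchanged. *)
Lemma kaon_widen c d : mdeg c = d ->
  kaon c = (\sum_(b : 'X_{1..n < (d + n).+1})
    \sum_(R : {set 'I_n} | mesonic_glide c b R) 'X ^+ #|R| *: 'X_[b])%R.
Proof. by move=> <-. Qed.

End Glides.

(* The degree bound on b excludes nothing: b^+ = a^+ forces mdeg b = mdeg a
   (pospart_mdeg). *)
Theorem proposition3p5 (n : nat) (hn : 0 < n) (a : 'X_{1..n}) :
  glide_poly a =
  (\sum_(b : 'X_{1..n < (mdeg a).+1} | wdom b a && (pospart b == pospart a))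
     kaon b)%R.
Proof.
under eq_bigr => c /andP[_ /eqP/pospart_mdeg/kaon_widen->] do [].
rewrite exchange_big /=; apply: eq_bigr => b _.
(* Every mesonic glide of an admissible [c] is a glide of [a], so the outer sum may be restricted to
   glides; the inner one then has a single term. *)
rewrite [RHS](exchange_big_dep (glide a b)) /=; last first.
  by move=> c R /andP[dom /eqP Pc]; apply: mesonic_glide_glide.
apply: eq_bigr => R /glide_mesonic_exists[c [dom Pc Mc]].
have lt_c : mdeg c < (mdeg a).+1 by rewrite (pospart_mdeg Pc).
rewrite (big_pred1 (BMultinom lt_c)) // => c'.
apply/idP/eqP => [/andP[/andP[_ /eqP Pc'] Mc']|->]; last first.
  by rewrite /= dom Pc eqxx.
by apply: val_inj; apply: mesonic_glide_inj Mc' Mc _; rewrite Pc' Pc.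
Qed.
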